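(* Let $G$ be a graph of order $n$ and let $u,v$ be two vertices of $G$ of degree at least $\frac{n+1}{2}$. Then there exists a path in $G$ with endpoints $u$ and $v$ which contains all vertices of $G$ of degree at least $\frac{n+1}{2}$.
   Context: All graphs are finite, undirected, without loops or multiple edges. *)

(* Defs.v *)
From mathcomp Require Import all_boot.

Set Implicit Arguments.
Unset Strict Implicit.
Unset Printing Implicit Defensive.

(* Finite simple graph: the vertex set is the whole finType T, and edges are  *)
(* undirected and loopless.                                                   *)
Definition simple_graph (T : finType) (e : rel T) : Prop :=
  symmetric e /\ irreflexive e.

Definition degree (T : finType) (e : rel T) (x : T) : nat :=
  #|[set y | e x y]|.

(* deg(x) >= (n + 1) / 2 as rational numbers, where n is the order of the     *)
(* graph; the denominator is cleared to avoid the truncated division of nat.  *)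
Definition large_degree (T : finType) (e : rel T) (x : T) : bool :=
  #|T| + 1 <= 2 * degree e x.

(* The vertex sequence u :: p is a path (no repeated vertex) from u to v.     *)
Definition is_path_between (T : finType) (e : rel T) (u v : T) (p : seq T) :
  bool := [&& path e u p, uniq (u :: p) & last u p == v].

(* Main.v *)
(** Among the sequences without repetition from [u] to [v] that contain every
    large vertex and whose consecutive vertices are adjacent or both large, take
    one with the fewest gaps, i.e. consecutive non-adjacent pairs. If [x], [y]
    is a gap, then [deg x + deg y >= n + 1], so by counting either [x] and [y]
    have a common neighbour off the sequence, which can be inserted between
    them, or the sequence has consecutive vertices [a], [b] with [a] adjacent to
    [x] and [b] adjacent to [y], and then reversing a segment replaces the pairs
    [x y] and [a b] by the edges [a x] and [b y]. Both moves remove a gap. *)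
Require Import Defs.
From mathcomp Require Import all_boot zify.

Set Implicit Arguments.
Unset Strict Implicit.
Unset Printing Implicit Defensive.

Section Gaps.

Variables (T : eqType) (e : rel T).

Fixpoint gaps (x : T) (p : seq T) : nat :=
  if p is y :: p' then ~~ e x y + gaps y p' else 0.

Lemma gaps_cat x p q : gaps x (p ++ q) = gaps x p + gaps (last x p) q.
Proof. by elim: p x => //= y p IH x; rewrite IH addnA. Qed.

Lemma gaps_rev x p :
  symmetric e -> gaps (last x p) (rev (belast x p)) = gaps x p.
Proof.
move=> e_sym; elim: p x => //= y p IH x.
rewrite rev_cons -cats1 gaps_cat IH /= addn0 addnC e_sym; congr (~~ e _ _ + _).
by case: p {IH} => //= z p; rewrite rev_cons last_rcons.
Qed.

Lemma gaps_eq0 x p : (gaps x p == 0) = path e x p.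
Proof. by elim: p x => //= y p IH x; rewrite addn_eq0 IH eqb0 negbK. Qed.

Lemma not_pathP x p :
  ~~ path e x p -> exists p1 y p2, p = p1 ++ y :: p2 /\ ~~ e (last x p1) y.
Proof.
elim: p x => //= y p IH x; rewrite negb_and => /orP[exy|/IH].
  by exists [::], y, p.
by case=> p1 [z [p2 [-> ez]]]; exists (y :: p1), z, p2.
Qed.

End Gaps.

Lemma last_rev_belast (T : Type) (x : T) p :
  last (last x p) (rev (belast x p)) = x.
Proof. by case: p => //= y p; rewrite rev_cons last_rcons. Qed.

Lemma rev_cons_belast (T : Type) (x : T) p :
  rev (x :: p) = last x p :: rev (belast x p).
Proof. by rewrite lastI rev_rcons. Qed.

(** By symmetry, reversal keeps the gaps inside the segment, so only its two junctions matter; the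
    two new ones are edges and contribute nothing. *)
Lemma gaps_rev_segment (T : eqType) (e : rel T) (u c d : T) (p q r : seq T) :
  symmetric e -> e (last u p) (last c q) -> e c d ->
  gaps e u (p ++ rev (c :: q) ++ d :: r) + ~~ e (last u p) c
    + ~~ e (last c q) d = gaps e u (p ++ (c :: q) ++ d :: r).
Proof.
move=> e_sym e1 e2; rewrite rev_cons_belast !gaps_cat /=.
by rewrite gaps_rev // last_rev_belast e1 e2 /=; lia.
Qed.

(** A path is a sequence with zero gaps, so the gap identity applies. The relation is kept general
    in order to use [quasi_adj]. *)
Lemma path_rev_segment (T : eqType) (e : rel T) (u c d : T) (p q r : seq T) :
  symmetric e -> e (last u p) (last c q) -> e c d ->
  path e u (p ++ (c :: q) ++ d :: r) ->
  path e u (p ++ rev (c :: q) ++ d :: r).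
Proof.
move=> e_sym e1 e2; rewrite -!gaps_eq0.
by have := gaps_rev_segment r e_sym e1 e2; lia.
Qed.

Lemma perm_rev_segment (T : eqType) (p q r : seq T) :
  perm_eq (p ++ rev q ++ r) (p ++ q ++ r).
Proof. by rewrite perm_cat2l perm_cat2r perm_rev. Qed.

(** Charge each consecutive pair for [P] at its first vertex and for [Q] at its second; no pair is
    charged twice. *)
Lemma count_no_crossing (T : Type) (P Q : pred T) (x : T) (p : seq T) :
  path (fun a b => ~~ (P a && Q b)) x p ->
  count P (belast x p) + count Q p <= size p.
Proof.
elim: p x => //= y p IH x /andP[xy /IH].
by case: (P x) (Q y) xy => [] [] //= _; lia.
Qed.

Lemma count_belast_last (T : Type) (P : pred T) (x : T) (p : seq T) :
  count P (x :: p) = count P (belast x p) + P (last x p).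
Proof. by rewrite lastI -cats1 count_cat /= addn0. Qed.

Section LargeDegrees.

Variables (T : finType) (e : rel T).
Hypotheses (e_sym : symmetric e) (e_irr : irreflexive e).

Lemma degree_count x (s : seq T) :
  uniq s -> degree e x = count (e x) s + #|[set y | e x y & y \notin s]|.
Proof.
move=> s_uniq; rewrite /degree -(cardsID [set y in s]); congr (_ + _).
  rewrite -size_filter -(card_uniqP (filter_uniq _ s_uniq)).
  by apply: eq_card => y; rewrite !inE mem_filter.
by apply: eq_card => y; rewrite !inE andbC.
Qed.

(** Outside [s] the neighbourhoods of [x] and [y] are disjoint, so together they have at most
    [#|T| - size s] vertices there. *)
Lemma degree_sum_off x y (s : seq T) :
  uniq s -> (forall z, e x z -> e y z -> z \in s) ->
  degree e x + degree e y + size s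
    <= #|T| + (count (e x) s + count (e y) s).
Proof.
move=> s_uniq common; rewrite !(degree_count _ s_uniq).
set X := [set z | e x z & _]; set Y := [set z | e y z & _].
have XY0 : X :&: Y = set0.
  apply/setP=> z; rewrite !inE; apply/negP.
  by case/andP=> /andP[xz /negP zs] /andP[yz _]; apply/zs/common.
have XYs : X :|: Y \subset ~: [set z in s].
  by apply/subsetP=> z; rewrite !inE; case/orP=> /andP[].
have := subset_leq_card XYs.
have := cardsC [set z in s]; rewrite cardsE (card_uniqP s_uniq).
by rewrite cardsU XY0 cards0; lia.
Qed.

Definition quasi_adj : rel T :=
  fun x y => e x y || (large_degree e x && large_degree e y).

Lemma quasi_adj_sym : symmetric quasi_adj.
Proof. by move=> x y; rewrite /quasi_adj e_sym andbC. Qed.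

Lemma edge_quasi_adj x y : e x y -> quasi_adj x y.
Proof. by rewrite /quasi_adj => ->. Qed.

Definition quasi_path (u v : T) (p : seq T) : Prop :=
  [/\ path quasi_adj u p, uniq (u :: p), last u p = v
    & forall w, large_degree e w -> w \in u :: p].

Lemma quasi_path_rev_segment u v c d (p q r : seq T) :
  e (last u p) (last c q) -> e c d ->
  quasi_path u v (p ++ (c :: q) ++ d :: r) ->
  quasi_path u v (p ++ rev (c :: q) ++ d :: r).
Proof.
move=> e1 e2 [quasi s_uniq s_last s_large].
have perm : perm_eq (u :: p ++ rev (c :: q) ++ d :: r)
                    (u :: p ++ (c :: q) ++ d :: r).
  by rewrite perm_cons perm_rev_segment.
split.
- by apply: path_rev_segment quasi; rewrite ?edge_quasi_adj //;
    apply: quasi_adj_sym.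
- by rewrite (perm_uniq perm).
- by move: s_last; rewrite !last_cat.
- by move=> w /s_large; rewrite (perm_mem perm).
Qed.

(** Without a crossing, [count_no_crossing] bounds the incidences of [x] and [y] with the sequence
    by [size p + size q], except those of [x] with the last vertex and of [y] with [u]. These add at
    most 2, which gives the length of the sequence, so the degrees of [x] and [y] would sum to at
    most [#|T|]. *)
Lemma large_crossing u y (p q : seq T) :
  let x := last u p in
  large_degree e x -> large_degree e y -> uniq (u :: p ++ y :: q) ->
  (forall z, e x z -> e y z -> z \in u :: p ++ y :: q) ->
  ~~ (path (fun a b => ~~ (e x a && e y b)) u p
      && path (fun a b => ~~ (e x a && e y b)) y q).
Proof.
move=> x x_large y_large s_uniq common; apply/negP => /andP[up yq].
have up_le := @count_no_crossing T (e x) (e y) _ _ up.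
have yq_le := @count_no_crossing T (e x) (e y) _ _ yq.
have := degree_sum_off s_uniq common.
rewrite -cat_cons !count_cat size_cat (count_belast_last (e x) u p).
rewrite (count_belast_last (e x) y q) -/x e_irr /= e_irr.
move: x_large y_large; rewrite /large_degree.
clear up yq; case: (e x (last y q)) (e y u) => [] [] /=; lia.
Qed.

Lemma quasi_path_improve u v p :
  quasi_path u v p -> ~~ path e u p ->
  exists2 p', quasi_path u v p' & gaps e u p' < gaps e u p.
Proof.
move=> qp /not_pathP[p1 [y [p2 [def_p gap]]]]; subst p.
have [quasi s_uniq s_last s_large] := qp.
set x := last u p1 in gap.
have [x_large y_large] : large_degree e x /\ large_degree e y.
  move: quasi; rewrite cat_path /= => /and3P[_ + _].
  by rewrite /quasi_adj (negbTE gap) /= => /andP.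
have [|no_common] :=
    boolP [exists z, [&& e x z, e y z & z \notin u :: p1 ++ y :: p2]].
  case/existsP=> z /and3P[xz yz z_off].
  have perm : perm_eq (u :: p1 ++ z :: y :: p2) (z :: u :: p1 ++ y :: p2).
    exact/permPl/(perm_catCA (u :: p1) [:: z] (y :: p2)).
  exists (p1 ++ z :: y :: p2); last first.
    by rewrite !gaps_cat /= -/x xz (e_sym z y) yz gap; lia.
  split.
  - move: quasi; rewrite !cat_path /= => /and3P[-> _ ->].
    by rewrite (edge_quasi_adj xz) quasi_adj_sym (edge_quasi_adj yz).
  - by rewrite (perm_uniq perm) cons_uniq z_off.
  - by move: s_last; rewrite !last_cat.
  - by move=> w /s_large w_in; rewrite (perm_mem perm) inE w_in orbT.
have common z : e x z -> e y z -> z \in u :: p1 ++ y :: p2.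
  move=> xz yz; apply/negPn/negP=> z_off.
  by case/existsP: no_common; exists z; rewrite xz yz.
have := large_crossing x_large y_large s_uniq common.
rewrite negb_and; case/orP=> /not_pathP[r1 [b [r2 [def_r]]]];
  rewrite negbK => /andP[xa yb]; subst.
(* Crossing [a b] before the gap: [.. a | b .. x | y ..] becomes [.. a | x .. b | y ..]. *)
- have last_x : last b r2 = x by rewrite /x last_cat.
  have ax : e (last u r1) (last b r2) by rewrite last_x e_sym.
  have b_y : e b y by rewrite e_sym.
  exists (r1 ++ rev (b :: r2) ++ y :: p2).
    by apply: quasi_path_rev_segment => //; rewrite catA.
  rewrite -catA -(gaps_rev_segment _ e_sym ax b_y) last_x gap; lia.
(* Crossing after the gap: [.. x | y .. a | b ..] becomes [.. x | a .. y | b ..]. *)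
- exists (p1 ++ rev (y :: r1) ++ b :: r2).
    exact: quasi_path_rev_segment.
  by rewrite -cat_cons -(gaps_rev_segment _ e_sym xa yb) -/x gap; lia.
Qed.

Lemma quasi_path_exists u v :
  u != v -> large_degree e u -> large_degree e v -> exists p, quasi_path u v p.
Proof.
move=> uv u_large v_large.
(* Large vertices are pairwise related by [quasi_adj], so they may be listed in any order between
   [u] and [v]. *)
pose s := [seq w <- enum T | [&& large_degree e w, w != u & w != v]].
have mem_s w : (w \in s) = [&& large_degree e w, w != u & w != v].
  by rewrite mem_filter mem_enum andbT.
exists (rcons s v); split.
- have all_large : all (large_degree e) (u :: rcons s v).
    rewrite /= all_rcons u_large v_large.
    by apply/allP=> w; rewrite mem_s => /and3P[].
  elim: (rcons s v) (u) all_large => //= y p IH x.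
  case/and3P=> x_large y_large p_large.
  by rewrite /quasi_adj x_large y_large orbT IH //= y_large.
- rewrite cons_uniq mem_rcons inE negb_or uv rcons_uniq !mem_s !eqxx !andbF.
  by rewrite filter_uniq ?enum_uniq.
- by rewrite last_rcons.
- move=> w w_large; rewrite inE mem_rcons inE mem_s w_large.
  by case: eqP => //; case: eqP.
Qed.

End LargeDegrees.

Theorem theorem1p5 (T : finType) (e : rel T) (u v : T) :
  simple_graph e ->
  u != v ->
  large_degree e u ->
  large_degree e v ->
  exists p : seq T,
    is_path_between e u v p /\
    (forall w : T, large_degree e w -> w \in u :: p).
Proof.
move=> [e_sym e_irr] uv u_large v_large.
have [p] := quasi_path_exists uv u_large v_large.
(* The choice of a sequence with fewest gaps takes the form of a descent on the number of gaps. *)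
have [n] := ubnP (gaps e u p); elim: n p => // n IH p lt_n qp.
have [p_path|/(quasi_path_improve e_sym e_irr qp)[p' qp' lt_p']] :=
  boolP (path e u p).
  have [_ p_uniq p_last p_large] := qp.
  by exists p; rewrite /is_path_between p_path p_uniq p_last eqxx.
by apply: IH qp'; lia.
Qed.
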